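(* Let $s=p_1\cdots p_m$ be a product of distinct prime numbers. Then every clone on $\mathbb{Z}_s$ containing $\mathrm{Clo}(\mathbb{Z}_{s},+)$ can be generated by a set of functions of arity at most $\max(p_1,\dots,p_m)$.
   Context: A clone on a set $A$ is a set of finitary functions $A^n\to A$ ($n\geq 1$) containing all projections and closed under composition; a clone is generated by a set of functions if it is the smallest clone containing that set. $\mathrm{Clo}(\mathbb{Z}_s,+)$ is the clone on $\mathbb{Z}_s$ generated by the addition of $\mathbb{Z}_s$. *)

(* Defs.v *)
From HB Require Import structures.
From mathcomp Require Import all_boot all_order all_algebra.
From mathcomp Require Import boolp classical_sets.

Set Implicit Arguments.
Unset Strict Implicit.
Unset Printing Implicit Defensive.

Import GRing.Theory.

Local Open Scope classical_set_scope.

Record operation (A : Type) := Operation {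
  arity : nat;
  op_fun : arity.-tuple A -> A }.
Arguments Operation {A} arity op_fun.

Definition op_proj (A : Type) (n : nat) (i : 'I_n) : operation A :=
  Operation n (fun x => tnth x i).
Arguments op_proj A {n} i.

(* f(g_1, ..., g_n), where f is n-ary and all the g_i are k-ary. *)
Definition op_comp (A : Type) (n k : nat) (f : n.-tuple A -> A)
    (g : 'I_n -> k.-tuple A -> A) : operation A :=
  Operation k (fun x => f [tuple g i x | i < n]).

(* The field clone_proj only concerns arities n >= 1, as 'I_0 is empty. *)
Record is_clone (A : Type) (C : set (operation A)) : Prop := IsClone {
  clone_arity : forall f, C f -> (0 < arity f)%N;
  clone_proj : forall (n : nat) (i : 'I_n), C (op_proj A i);
  clone_comp : forall (n k : nat) (f : n.-tuple A -> A)
      (g : 'I_n -> k.-tuple A -> A),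
    C (Operation n f) -> (forall i, C (Operation k (g i))) ->
    C (op_comp f g) }.

Definition Clo (A : Type) (F : set (operation A)) : set (operation A) :=
  smallest (@is_clone A) F.

Lemma is_clone_Clo (A : Type) (F : set (operation A)) :
  (forall f, F f -> (0 < arity f)%N) -> is_clone (Clo F).
Proof.
move=> F_gt0.
have pos_clone : is_clone [set f : operation A | (0 < arity f)%N].
  split=> [//|n i|n k f g /= n_gt0 g_gt0]; first exact: leq_ltn_trans (ltn_ord i).
  exact: g_gt0 (Ordinal n_gt0).
split.
- by move=> f /(_ _ (conj pos_clone F_gt0)).
- by move=> n i C [cC _]; apply: clone_proj cC _ _.
- move=> n k f g Ff Fg C CF; case: (CF) => cC _.
  by apply: (clone_comp cC) => [|i]; [apply: Ff CF | apply: Fg CF].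
Qed.

(* 'Z_s is the ring of integers modulo s only when s > 1. *)
Definition op_add (s : nat) : operation 'Z_s :=
  Operation 2 (fun x => (tnth x ord0 + tnth x ord_max)%R).

(* Main.v *)
(* Multiplying by the idempotents of Z_s reduces the theorem to operations e f, where f
   is in the clone C and e is the idempotent of a prime p. Such a function depends on
   the p-parts x of its arguments and on the remaining parts y. Since the other primes
   are invertible modulo p, averaging over lines writes e f as a linear combination of
   functions f(x, a (b . y)), in which y enters only through the single element b . y.
   Expanding in powers of the x_j and polarizing leaves operations e x_1 ... x_d h(t).
   For d <= p these have arity at most p, because t can be carried by the prime-to-p
   part of x_1. For larger d, Fermat's little theorem shows that e x_1 ... x_d h(t)
   lies in C iff e x_1 ... x_d' h(t) does, where 2 <= d' <= p and d' = d mod p - 1: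
   identify variables to decrease d, and compose the operation with itself to increase
   it, the power of h reached being h^(1 + k(p - 1)), which agrees with h. *)
Require Import Defs.
From HB Require Import structures.
From mathcomp Require Import all_boot all_order all_algebra.
From mathcomp Require Import finfield.
From mathcomp Require Import ring.
From mathcomp Require Import boolp classical_sets.

Set Implicit Arguments.
Unset Strict Implicit.
Unset Printing Implicit Defensive.

Import GRing.Theory.

Lemma pred_funext (X Y : Type) (P : (X -> Y) -> Prop) (F G : X -> Y) :
  F =1 G -> P F -> P G.
Proof. by move=> /funext->. Qed.

(** * Finite fields *)

Section FiniteFields.
Local Open Scope ring_scope.
Variable K : finFieldType.

Lemma sum_affine (V : zmodType) (G : K -> V) (u c : K) :
  u != 0 -> \sum_b G (b * u + c) = \sum_b G (b * u).
Proof.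
move=> u0; have affE d : \sum_b G (b * u + d) = \sum_b G b.
  rewrite [RHS](reindex_inj (h := fun b => b * u + d)) //=.
  by apply: (inj_comp (addIr d)) (mulIf u0).
by rewrite affE -(affE 0); apply: eq_bigr => b _; rewrite addr0.
Qed.

(* Every point other than the origin lies on exactly one line through the
   origin; the lines not containing (x, y) contribute 0 by sum_affine. *)
Lemma sum_over_lines (V : zmodType) (F : K -> K -> V) (x y : K) :
  F x y *+ #|K| = F 0 0 *+ #|K|
    + \sum_l \sum_b (F (b * (y - l * x) + x) (l * (b * (y - l * x) + x))
                     - F (b * (y - l * x)) (l * (b * (y - l * x))))
    + \sum_b (F 0 (b * x + y) - F 0 (b * x)).
Proof.
have lineE l : y - l * x != 0 -> \sum_b (F (b * (y - l * x) + x) (l * (b * (y - l * x) + x))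
   - F (b * (y - l * x)) (l * (b * (y - l * x)))) = 0.
  by move=> u0; rewrite sumrB (sum_affine (fun t => F t (l * t))) // subrr.
have [x0 | x0] := eqVneq x 0.
  rewrite x0 [X in _ + X + _]big1 ?addr0; last first.
    by move=> l _; apply: big1 => b _; rewrite mulr0 subr0 addr0 subrr.
  rewrite (eq_bigr (fun=> F 0 y - F 0 0)) => [|b _]; last by rewrite mulr0 add0r.
  by rewrite sumr_const -mulrnDl addrC subrK.
rewrite [X in _ + _ + X]sumrB (sum_affine (F 0)) // subrr addr0.
rewrite (bigD1 (y / x)) //= [X in _ + (_ + X)]big1 => [|l ne_l]; last first.
  by apply: lineE; apply: contra ne_l; rewrite subr_eq0 => /eqP->; rewrite mulfK.
rewrite addr0 divfK // subrr.
rewrite (eq_bigr (fun=> F x y - F 0 0)) => [|b _]; last first.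
  by rewrite !mulr0 add0r divfK.
by rewrite sumr_const -mulrnDl addrC subrK.
Qed.

(** The two products of the Vandermonde matrix on all points of [K] with its inverse. One extracts a
    coefficient of a polynomial from its values, the other interpolates the indicator of a point. *)
Lemma Vandermonde_inverse : exists W : K -> nat -> K,
  (forall k l : 'I_#|K|, \sum_x W x k * x ^+ l = (k == l)%:R) /\
  (forall x y : K, \sum_(k < #|K|) W x k * y ^+ k = (x == y)%:R).
Proof.
pose n := #|K|; pose a : 'rV[K]_n := \row_j enum_val j.
have Vunit : Vandermonde n a \in unitmx.
  rewrite unitmxE unitfE det_Vandermonde.
  apply/prodf_neq0 => i _; apply/prodf_neq0 => j lt_ij.
  by rewrite !mxE subr_eq0 (inj_eq enum_val_inj); apply: contraTneq lt_ij => ->; rewrite ltnn.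
pose W := invmx (Vandermonde n a).
exists (fun x k => if insub k is Some i then W (enum_rank x) i else 0); split=> [k l|x y].
  move/matrixP/(_ l k): (mulmxV Vunit); rewrite !mxE eq_sym => <-.
  rewrite (eq_bigl (mem K)) // big_enum_val; apply: eq_bigr => i _.
  by rewrite !mxE enum_valK valK mulrC.
move/matrixP/(_ (enum_rank x) (enum_rank y)): (mulVmx Vunit).
rewrite !mxE (inj_eq enum_rank_inj) => <-; apply: eq_bigr => i _.
by rewrite !mxE enum_rankK valK.
Qed.

Lemma expf_card_pred (x : K) (k : nat) : x ^+ (k * #|K|.-1).+1 = x.
Proof.
elim: k => [|k IHk]; first by rewrite mul0n expr1.
have K_gt0 : (0 < #|K|)%N by apply/card_gt0P; exists 0.
by rewrite mulSn addnC -addSn exprD IHk -exprS prednK // expf_card.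
Qed.

End FiniteFields.

(** * Linear spans *)

Section LinearlyClosed.
Local Open Scope ring_scope.
Variable R : comNzRingType.

Record lin_closed (X : Type) (S : (X -> R) -> Prop) : Prop := LinClosed {
  lin0 : S (fun=> 0);
  linD : forall F G, S F -> S G -> S (fun v => F v + G v);
  linZ : forall c F, S F -> S (fun v => c * F v) }.

Variables (X : Type) (S : (X -> R) -> Prop).
Hypothesis linS : lin_closed S.

Lemma lin_sum (I : Type) (r : seq I) (F : I -> X -> R) :
  (forall i, S (F i)) -> S (fun v => \sum_(i <- r) F i v).
Proof.
move=> SF; elim: r => [|i r IHr].
  by apply: pred_funext (lin0 linS) => v; rewrite big_nil.
by apply: pred_funext (linD linS (SF i) IHr) => v; rewrite big_cons.
Qed.

Lemma linB (F G : X -> R) : S F -> S G -> S (fun v => F v - G v).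
Proof.
move=> SF SG; apply: pred_funext (linD linS SF (linZ linS (-1) SG)) => v.
by rewrite mulN1r.
Qed.

End LinearlyClosed.

(* For R = 'Z_s, the component at a prime factor p of s: reduction modulo p, and the
   idempotent that is 1 modulo p and 0 modulo s / p. *)
Record component (R : comNzRingType) (K : finFieldType) := Component {
  res : {rmorphism R -> K};
  lift : K -> R;
  idem : R;
  liftK : cancel lift res;
  res_idem : res idem = 1%R;
  eq_idem : forall r r' : R, res r = res r' -> (idem * r = idem * r')%R }.

Section Component.
Local Open Scope ring_scope.
Variables (R : comNzRingType) (K : finFieldType) (c : component R K).
Local Notation e := (idem c).

Lemma idem_id : e * e = e.
Proof. by rewrite -[RHS]mulr1; apply: eq_idem; rewrite res_idem rmorph1. Qed.

(** Evaluation at the points [r = lift c x], weighted by [W x k], isolates a coefficient; the factor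
    [e] lets this be computed in [K]. *)
Lemma lin_closed_coef (X : Type) (S : (X -> R) -> Prop) (linS : lin_closed S)
    (A : nat -> X -> R) :
  (forall r, S (fun v => e * \sum_(k < #|K|) r ^+ k * A k v)) ->
  forall k, (k < #|K|)%N -> S (fun v => e * A k v).
Proof.
move=> SA k lt_k; have [W [W1 _]] := Vandermonde_inverse K.
have -> : (fun v => e * A k v) = fun v => \sum_x lift c (W x k)
    * (e * \sum_(l < #|K|) lift c x ^+ l * A l v).
  apply: funext => v; rewrite (eq_bigr _ (fun _ _ => mulrCA _ _ _)) -mulr_sumr.
  apply: eq_idem; rewrite rmorph_sum /=.
  under eq_bigr => x _.
    rewrite rmorphM rmorph_sum /= liftK mulr_sumr.
    under eq_bigr => l _ do rewrite rmorphM rmorphXn /= liftK mulrA.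
    over.
  rewrite exchange_big /=.
  under eq_bigr => l _ do rewrite -mulr_suml (W1 (Ordinal lt_k)).
  rewrite (bigD1 (Ordinal lt_k)) //= eqxx mul1r big1 ?addr0 // => l.
  by rewrite eq_sym => /negPf->; rewrite mul0r.
by apply: lin_sum => // x; apply: (linZ linS).
Qed.

End Component.

(** * Reduction to substitutions of rank one *)

Section RankOne.
Local Open Scope ring_scope.
Variables (R : comNzRingType) (n : nat).

Definition dot (b z : 'I_n -> R) : R := \sum_l b l * z l.

Lemma dotDZ (r r' : R) (d d' z : 'I_n -> R) :
  dot (fun l => r * d l + r' * d' l) z = r * dot d z + r' * dot d' z.
Proof.
rewrite /dot !mulr_sumr -big_split; apply: eq_bigr => l _.
by rewrite /= mulrDl !mulrA.
Qed.

Variables (S : (('I_n -> R) -> R) -> Prop).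
Hypothesis linS : lin_closed S.

(* A sum of k + 2 rank one terms a_i (b_i . z) is brought down to k + 1 terms by
   sum_over_lines, applied to the coefficients of the last two. *)
Lemma rank_one_generates (K : finFieldType) (c : component R K) (u : R)
    (f : ('I_n -> R) -> R) (f_card : forall z, u * (f z *+ #|K|) = f z) :
  (forall a b, S (fun z => f (fun j => (1 - idem c) * z j + idem c * (a j * dot b z)))) ->
  S f.
Proof.
set e := idem c => Sf.
have Sf_rank k (a b : nat -> 'I_n -> R) : S (fun z => f (fun j =>
    (1 - e) * z j + e * \sum_(i < k.+1) a i j * dot (b i) z)).
  elim: k a b => [|k IHk] a b.
    have := Sf (a 0%N) (b 0%N); apply: pred_funext => z; congr f.
    by apply: funext => j; rewrite big_ord1.
  have Sadd (a' b' : 'I_n -> R) : S (fun z => f (fun j => (1 - e) * z j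
      + e * (\sum_(i < k) a i j * dot (b i) z + a' j * dot b' z))).
    pose upd (d : nat -> 'I_n -> R) d' i := if i == k then d' else d i.
    have := IHk (upd a a') (upd b b'); apply: pred_funext => z; congr f.
    apply: funext => j; rewrite big_ord_recr /= /upd eqxx.
    by congr (_ + e * (_ + _)); apply: eq_bigr => i _; rewrite (ltn_eqF (ltn_ord i)).
  (* The coefficients of the last two terms are freed: on a line through the origin these terms
     merge into one, and [Sadd] applies. *)
  pose F z x y := f (fun j => (1 - e) * z j + e * (\sum_(i < k) a i j * dot (b i) z
    + (a k j * lift c x + a k.+1 j * lift c y))).
  have SF1 l b' : S (fun z => F z (res c (dot b' z)) (l * res c (dot b' z))).
    have := Sadd (fun j => a k j + a k.+1 j * lift c l) b'; apply: pred_funext => z.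
    congr f; apply: funext => j; congr (_ + _).
    by apply: eq_idem; rewrite !(rmorphD, rmorphM) /= !liftK; ring.
  have SF2 b' : S (fun z => F z 0 (res c (dot b' z))).
    have := Sadd (a k.+1) b'; apply: pred_funext => z; congr f; apply: funext => j; congr (_ + _).
    by apply: eq_idem; rewrite !(rmorphD, rmorphM) /= !liftK; ring.
  have SF0 : S (fun z => F z 0 0).
    have := SF2 (fun=> 0); apply: pred_funext => z; congr (F z 0 _).
    by rewrite /dot big1 ?rmorph0 // => l _; rewrite mul0r.
  pose x z := res c (dot (b k) z); pose y z := res c (dot (b k.+1) z).
  have resE (r r' : R) z : res c (dot (fun l => r * b k l + r' * b k.+1 l) z)
      = res c r * x z + res c r' * y z.
    by rewrite dotDZ rmorphD !rmorphM.
  have -> : (fun z => f (fun j => (1 - e) * z j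
        + e * \sum_(i < k.+2) a i j * dot (b i) z)) = fun z => u * (F z (x z) (y z) *+ #|K|).
    apply: funext => z; rewrite f_card; congr f; apply: funext => j.
    rewrite !big_ord_recr /= -addrA; congr (_ + _).
    by apply: eq_idem; rewrite !(rmorphD, rmorphM) /= !liftK.
  apply: (linZ linS).
  have -> : (fun z => F z (x z) (y z) *+ #|K|) = _ := funext (fun z => sum_over_lines _ _ _).
  apply: (linD linS); last first.
    apply: lin_sum => // t; apply: linB => //.
      have := SF2 (fun l => lift c t * b k l + 1 * b k.+1 l); apply: pred_funext => z.
      by rewrite resE liftK rmorph1 mul1r.
    have := SF2 (fun l => lift c t * b k l + 0 * b k.+1 l); apply: pred_funext => z.
    by rewrite resE liftK rmorph0 mul0r addr0.
  apply: (linD linS).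
    have := linZ linS (#|K|%:R) SF0; apply: pred_funext => z.
    by rewrite mulr_natl.
  apply: lin_sum => // l; apply: lin_sum => // t; apply: linB => //.
    have := SF1 l (fun j => (1 - lift c t * lift c l) * b k j + lift c t * b k.+1 j).
    apply: pred_funext => z; rewrite resE !(rmorphB, rmorphM, rmorph1) /= !liftK.
    by congr (F z _ (l * _)); ring.
  have := SF1 l (fun j => (- (lift c t * lift c l)) * b k j + lift c t * b k.+1 j).
  apply: pred_funext => z; rewrite resE !(rmorphN, rmorphM) /= !liftK.
  by congr (F z _ (l * _)); ring.
(* The identity as [n.+1] rank one terms, the one of index [n] being zero. *)
pose a i (j : 'I_n) : R := (i == j :> nat)%:R.
have := Sf_rank n a a; apply: pred_funext => z; congr f; apply: funext => j.
rewrite (bigD1 (widen_ord (leqnSn n) j)) //=.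
rewrite big1 => [|i ne_i]; last first.
  by rewrite /a (_ : (i == j :> nat) = false) ?mul0r //; apply: contraNF ne_i.
rewrite /a eqxx mul1r addr0 /dot (bigD1 j) //= eqxx mul1r big1 ?addr0 => [|l ne_l].
  by ring.
by rewrite (_ : (j == l :> nat) = false) ?mul0r // eq_sym; apply: contraNF ne_l.
Qed.

End RankOne.

(** * Clones *)

Section CloneFunctions.
Variable A : Type.
Implicit Types (C : set (operation A)) (T U : finType).

(** Variables are indexed by a finite type, so that substitution needs no renumbering. *)
Definition clone_fun C T (F : (T -> A) -> A) : Prop :=
  C (Operation #|T| (fun t => F (fun x => tnth t (enum_rank x)))).

Lemma clone_fun_proj C T (x : T) : is_clone C -> clone_fun C (fun z : T -> A => z x).
Proof. by move=> cC; apply: (clone_proj cC (enum_rank x)). Qed.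

Lemma clone_fun_comp C T U (F : (T -> A) -> A) (G : T -> (U -> A) -> A) :
  is_clone C -> clone_fun C F -> (forall x, clone_fun C (G x)) ->
  clone_fun C (fun z => F (fun x => G x z)).
Proof.
move=> cC CF CG; have := clone_comp cC CF (fun i => CG (enum_val i)).
congr (C (Operation _ _)); apply: funext => t; congr F; apply: funext => x.
by rewrite tnth_mktuple enum_rankK.
Qed.

Lemma clone_funE C n (f : n.-tuple A -> A) : is_clone C ->
  C (Operation n f) <-> clone_fun C (fun z : 'I_n -> A => f [tuple z i | i < n]).
Proof.
move=> cC; split=> [Cf | Cf].
  exact: (clone_comp cC Cf (fun i => clone_proj cC (enum_rank i))).
have := clone_comp cC Cf (fun i => clone_proj cC (enum_val i)).
congr (C (Operation _ _)); apply: funext => t; congr f; apply: eq_from_tnth => i.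
by rewrite !tnth_mktuple enum_rankK.
Qed.

Lemma clone_fun_gt0 C T (F : (T -> A) -> A) :
  is_clone C -> clone_fun C F -> (0 < #|T|)%N.
Proof. by move=> cC /(clone_arity cC). Qed.

End CloneFunctions.

(** * Monomial operations at one prime *)

Section Monomials.
Local Open Scope ring_scope.
Variables (R : comNzRingType) (K : finFieldType) (c : component R K).
Hypothesis natK_neq0 : forall k, (0 < k < #|K|)%N -> k%:R != 0 :> K.
Variables (C C' : set (operation R)).
Hypotheses (cC : is_clone C) (cC' : is_clone C').
Hypothesis linC : forall U : finType, (0 < #|U|)%N -> lin_closed (@clone_fun R C U).
Hypothesis linC' : forall U : finType, (0 < #|U|)%N -> lin_closed (@clone_fun R C' U).
Hypothesis smallC : forall (U : finType) (F : (U -> R) -> R),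
  (#|U| <= #|K|)%N -> clone_fun C F -> clone_fun C' F.
Variable n : nat.
Local Notation e := (idem c).

(* Membership of e x_1 ... x_d psi(z, t), stated through all substitution instances
   so that no finite type of variables has to be fixed. *)
Definition monomial_in (D : set (operation R)) d (psi : ('I_n -> R) -> R -> R) :=
  forall (U : finType) (z : 'I_n -> (U -> R) -> R) (x : nat -> (U -> R) -> R) (t : (U -> R) -> R),
    (forall j, clone_fun D (z j)) -> (forall i, clone_fun D (x i)) -> clone_fun D t ->
    clone_fun D (fun v => e * (\prod_(i < d) x i v) * psi (fun j => z j v) (t v)).

(* Replacing y by y + r w in y^j and taking the coefficient of r gives j y^(j-1) w;
   k such steps turn y^k into a product of k distinct variables. *)
Lemma polarize d k psi : (k < #|K|)%N ->
  (forall (U : finType) z (x : nat -> (U -> R) -> R) (y t : (U -> R) -> R),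
    (forall j, clone_fun C (z j)) -> (forall i, clone_fun C (x i)) ->
    clone_fun C y -> clone_fun C t ->
    clone_fun C (fun v => e * ((\prod_(i < d) x i v) * y v ^+ k * psi (fun j => z j v) (t v)))) ->
  monomial_in C (d + k) psi.
Proof.
move=> lt_k Ck.
have Cl l : (l <= k)%N -> forall (U : finType) z (x : nat -> (U -> R) -> R) (y t : (U -> R) -> R),
    (forall j, clone_fun C (z j)) -> (forall i, clone_fun C (x i)) ->
    clone_fun C y -> clone_fun C t ->
    clone_fun C (fun v => e * ((\prod_(i < d + l) x i v) * y v ^+ (k - l)
      * psi (fun j => z j v) (t v))).
  elim: l => [|l IHl] le_l U z x y t Cz Cx Cy Ct; first by rewrite addn0 subn0; apply: Ck.
  have linCU := linC (clone_fun_gt0 cC Ct).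
  pose A i v := (\prod_(j < d + l) x j v)
    * (y v ^+ (k - l - i) * x (d + l)%N v ^+ i *+ 'C(k - l, i)) * psi (fun j => z j v) (t v).
  have lt1 : (1 < #|K|)%N by apply: leq_ltn_trans lt_k; apply: leq_trans le_l.
  have CA1 : clone_fun C (fun v => e * A 1%N v).
    apply: (@lin_closed_coef _ _ c _ _ linCU A) => // r.
    have Cyr := linD linCU Cy (linZ linCU r (Cx (d + l)%N)).
    have := IHl (ltnW le_l) U z x _ t Cz Cx Cyr Ct; apply: pred_funext => v.
    congr (e * _); rewrite exprDn mulr_sumr mulr_suml.
    rewrite (big_ord_widen #|K| (fun i => (\prod_(j < d + l) x j v)
      * (y v ^+ (k - l - i) * (r * x (d + l)%N v) ^+ i *+ 'C(k - l, i))
      * psi (fun j => z j v) (t v))); last first.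
      by rewrite (leq_ltn_trans _ lt_k) // leq_subr.
    rewrite big_mkcond; apply: eq_bigr => i _; case: ifP => [_ | /negbT]; rewrite /A.
      by rewrite exprMn !mulrnAr !mulrnAl !mulrnAr; congr (_ *+ _); ring.
    by rewrite -leqNgt => /bin_small->; rewrite !mulr0n !(mulr0, mul0r).
  have kl_neq0 : (k - l)%:R != 0 :> K.
    by apply: natK_neq0; rewrite subn_gt0 le_l (leq_ltn_trans _ lt_k) // leq_subr.
  have := linZ linCU (lift c (k - l)%:R^-1) CA1; apply: pred_funext => v.
  rewrite mulrCA; apply: eq_idem; rewrite /A bin1 addnS big_ord_recr /= -subnDA addn1.
  rewrite !(rmorphM, rmorphMn) /= liftK !rmorphXn -mulr_natr.
  by field.
(* At [l = k] the exponent of [y] is 0, so [t] may stand for [y]. *)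
move=> U z x t Cz Cx Ct; have := Cl k (leqnn k) U z x t t Cz Cx Ct Ct.
by apply: pred_funext => v; rewrite subnn expr0 mulr1 mulrA.
Qed.

(* The argument t needs no variable of its own: e kills its contribution to
   e x_0 + (1 - e) t, and h ignores that of x_0. *)
Lemma monomial_small d (h : R -> R) : (forall t, h ((1 - e) * t) = h t) ->
  (d <= #|K|)%N -> monomial_in C d (fun=> h) -> monomial_in C' d (fun=> h).
Proof.
move=> he le_d Ch U z x t _ Cx Ct.
have linCU := linC' (clone_fun_gt0 cC' Ct).
have K_gt0 : (0 < #|K|)%N by apply/card_gt0P; exists 0.
(* [d.-1.+1] is [d], or 1 when [d = 0]: the variable [ord0] must exist to carry [t]. *)
have Cd : clone_fun C' (fun v : 'I_d.-1.+1 -> R => e * (\prod_(i < d) v (inord i)) * h (v ord0)).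
  apply: smallC; first by rewrite card_ord; case: (d) le_d.
  by apply: (Ch _ (fun _ v => v ord0) (fun i v => v (inord i))) => *; apply: clone_fun_proj.
have Cy i : clone_fun C' (fun v => e * x i v + (1 - e) * t v).
  by apply: (linD linCU); apply: (linZ linCU).
have := clone_fun_comp cC' Cd (fun i : 'I_d.-1.+1 => Cy i); apply: pred_funext => v /=.
have ee := idem_id c; congr (_ * _); last first.
  by rewrite -he -[RHS]he; congr h; rewrite mulrDr !mulrA; ring: ee.
apply: eq_idem; rewrite !rmorph_prod; apply: eq_bigr => i _ /=.
rewrite inordK; last by case: (d) i => [[] | //].
by rewrite rmorphD !rmorphM rmorphB rmorph1 /= res_idem subrr mul0r addr0 mul1r.
Qed.

(* Modulo p both exponents, of the variables and of h, may be changed by multiples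
   of p - 1 as long as they stay positive. *)
Lemma monomial_const d (h : R -> R) : (forall t, h ((1 - e) * t) = h t) ->
  monomial_in C d (fun=> h) -> monomial_in C' d (fun=> h).
Proof.
move=> he Ch.
have K_gt1 : (1 < #|K|)%N by apply: card_finNzRing_gt1.
have [lt_d|le_d] := ltnP d 2; first by exact: monomial_small he (leq_trans (ltnW lt_d) K_gt1) Ch.
(* With [d'] at least 2, the monomial has one place for its own output and one for a new
   variable. *)
pose M := ((d - 2) %/ #|K|.-1 * #|K|.-1)%N; pose r := ((d - 2) %% #|K|.-1)%N; pose d' := r.+2.
have def_d : d = (d' + M)%N.
  by rewrite /d' !addSn addnC -divn_eq -add2n subnKC.
have le_d' : (d' <= #|K|)%N.
  have : ((d - 2) %% #|K|.-1 < #|K|.-1)%N by rewrite ltn_pmod // -subn1 subn_gt0.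
  by rewrite -/r -subn1 ltn_subRL add1n.
have expM (y : K) : y ^+ M.+1 = y by apply: expf_card_pred.
have Ch' : monomial_in C' d' (fun=> h).
  apply: monomial_small => // U z x t Cz Cx Ct.
  pose x' i := if (i < d')%N then x i else x 0%N.
  have Cx' i : clone_fun C (x' i) by rewrite /x'; case: ifP.
  have := Ch U z x' t Cz Cx' Ct; apply: pred_funext => v; congr (_ * _).
  apply: eq_idem; rewrite def_d big_split_ord /= [X in _ * X](eq_bigr (fun=> x 0%N v)); last first.
    by move=> i _; rewrite /x' ltnNge leq_addr.
  rewrite prodr_const card_ord !rmorphM rmorphXn.
  have -> : \prod_(i < d') x' i v = \prod_(i < d') x i v.
    by apply: eq_bigr => i _; rewrite /x' ltn_ord.
  rewrite big_ord_recl !rmorphM /=.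
  by rewrite -[in RHS](expM (res c (x 0%N v))) exprS; ring.
have prodE (F : nat -> R) : \prod_(i < d') F i = F 0%N * F 1%N * \prod_(i < r) F i.+2.
  by rewrite !big_ord_recl mulrA.
move=> U z x t Cz Cx Ct.
(* The result of [j] nested uses of the [d']-fold monomial: each takes the last output, one new
   variable and [r] copies of [x 1], and leaves a factor [h (t v)]. *)
pose acc j v := x 0%N v * (\prod_(i < j) (x (d' + i)%N v * x 1%N v ^+ r * h (t v))).
have Cacc j : clone_fun C' (fun v => e * acc j v).
  have linCU := linC' (clone_fun_gt0 cC' Ct).
  elim: j => [|j IHj].
    have := linZ linCU e (Cx 0%N); apply: pred_funext => v.
    by rewrite /acc big_ord0 mulr1.
  pose x' i := match i with 0 => fun v => e * acc j v | 1 => x (d' + j)%N | _ => x 1%N end.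
  have Cx' i : clone_fun C' (x' i) by case: i => [|[|i]]; [exact: IHj | exact: Cx | exact: Cx].
  have := Ch' U z x' t Cz Cx' Ct; apply: pred_funext => v.
  have -> : \prod_(i < d') x' i v = e * acc j v * (x (d' + j)%N v * x 1%N v ^+ r).
    by rewrite (prodE (fun i => x' i v)) /= prodr_const card_ord mulrA.
  rewrite /acc big_ord_recr /= -!mulrA; apply: eq_idem.
  by rewrite !rmorphM /= res_idem !mul1r; ring.
(* A last use supplies [x 1] to [x d'.-1]. Then [x 1] and [h (t v)] have exponents [1 + r * M] and
   [1 + M], which reduce to 1 in [K]. *)
pose x' i := match i with 0 => fun v => e * acc M v | _ => x i end.
have Cx' i : clone_fun C' (x' i) by case: i => [|i]; [exact: Cacc | exact: Cx].
have := Ch' U z x' t Cz Cx' Ct; apply: pred_funext => v.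
rewrite -!mulrA; apply: eq_idem; rewrite def_d big_split_ord /=.
rewrite (prodE (fun i => x' i v)) (prodE (fun i => x i v)) /= /acc !big_split /=.
rewrite !prodr_const card_ord !rmorphM /= res_idem !rmorphXn /= -!exprM.
have expM' (y : K) k : y * y ^+ (k * M) = y.
  by elim: k => [|k IHk]; rewrite ?mul0n ?mulr1 // mulSn exprD mulrA -exprS expM IHk.
rewrite -[in RHS](expM (res c (h (t v)))) exprS.
rewrite -[in RHS](expM' (res c (x 1%N v)) r).
by ring.
Qed.

(* psi is expanded as a polynomial in one variable z_j at a time; each term is again
   in C by lin_closed_coef, and its power of z_j is absorbed into the monomial. *)
Lemma monomial_all (s : seq 'I_n) d (psi : ('I_n -> R) -> R -> R) :
  (forall z z' t, {in s, forall j, e * z j = e * z' j} -> e * psi z t = e * psi z' t) ->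
  (forall z t, psi z ((1 - e) * t) = psi z t) ->
  monomial_in C d psi -> monomial_in C' d psi.
Proof.
elim: s d psi => [|j0 s IHs] d psi psi_e psi_t Cpsi.
  (* No coordinate is left: modulo [e], [psi] ignores [z]. *)
  have psi0 z t : e * psi z t = e * psi (fun=> 0) t by apply: psi_e.
  suff C'psi : monomial_in C' d (fun=> psi (fun=> 0)).
    move=> U z x t Cz Cx Ct; apply: pred_funext (C'psi U z x t Cz Cx Ct) => v.
    by rewrite mulrAC -(psi0 (fun j => z j v)) mulrAC.
  apply: monomial_const => [t | U z x t Cz Cx Ct]; first exact: psi_t.
  by apply: pred_funext (Cpsi U z x t Cz Cx Ct) => v; rewrite mulrAC psi0 mulrAC.
have [W [_ W2]] := Vandermonde_inverse K.
pose upd (z : 'I_n -> R) r j := if j == j0 then r else z j.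
(* The coefficient of the [k]-th power of coordinate [j0], by interpolation. *)
pose psik k z t := \sum_(y : K) lift c (W y k) * psi (upd z (lift c y)) t.
have psikE z t r : e * (\sum_(k < #|K|) r ^+ k * psik k z t) = e * psi (upd z r) t.
  have -> : e * psi (upd z r) t = e * psi (upd z (lift c (res c r))) t.
    apply: psi_e => j _; rewrite /upd; case: ifP => // _.
    by apply: eq_idem; rewrite liftK.
  apply: eq_idem; rewrite rmorph_sum /=.
  under eq_bigr => k _.
    rewrite rmorphM rmorphXn rmorph_sum /= mulr_sumr.
    under eq_bigr => y _ do rewrite rmorphM /= liftK mulrCA mulrA.
    over.
  rewrite exchange_big /=.
  under eq_bigr => y _ do rewrite -mulr_suml W2.
  rewrite (bigD1 (res c r)) //= eqxx mul1r big1 ?addr0 // => y /negPf->.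
  by rewrite mul0r.
have Cpsik k : (k < #|K|)%N -> monomial_in C (d + k) (psik k).
  move=> lt_k; apply: polarize => // U z x y t Cz Cx Cy Ct.
  have linCU := linC (clone_fun_gt0 cC Ct).
  pose A k v := (\prod_(i < d) x i v) * y v ^+ k * psik k (fun j => z j v) (t v).
  apply: (@lin_closed_coef _ _ c _ _ linCU A) => // r.
  (* With [r * y] for [z j0], the coefficient of [r ^+ k] contains [y ^+ k], as [polarize]
     requires. *)
  pose z' j := if j == j0 then fun v => r * y v else z j.
  have Cz' j : clone_fun C (z' j).
    by rewrite /z'; case: ifP => // _; apply: (linZ linCU).
  have := Cpsi U z' x t Cz' Cx Ct; apply: pred_funext => v.
  rewrite mulrAC (_ : (fun j => z' j v) = upd (z^~ v) (r * y v)); last first.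
    by apply: funext => j; rewrite /z' /upd; case: ifP.
  rewrite -psikE -mulrA mulr_suml; congr (e * _); apply: eq_bigr => k' _.
  by rewrite /A exprMn; ring.
have C'psik k : (k < #|K|)%N -> monomial_in C' (d + k) (psik k).
  move=> lt_k; apply: IHs (Cpsik k lt_k) => [z z' t zz' | z t].
    rewrite /psik !mulr_sumr; apply: eq_bigr => y _; rewrite !(mulrCA e); congr (_ * _).
    apply: psi_e => j; rewrite inE /upd; case: eqP => //= _; exact: zz'.
  by apply: eq_bigr => y _; rewrite psi_t.
move=> U z x t Cz Cx Ct.
have linCU := linC' (clone_fun_gt0 cC' Ct).
have Csum : clone_fun C' (fun v => \sum_(k < #|K|) (e * (\prod_(i < d) x i v)
    * z j0 v ^+ k * psik k (fun j => z j v) (t v))).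
  apply: lin_sum => // k.
  pose x' i := if (i < d)%N then x i else z j0.
  have Cx' i : clone_fun C' (x' i) by rewrite /x'; case: ifP.
  have := C'psik k (ltn_ord k) U z x' t Cz Cx' Ct; apply: pred_funext => v.
  congr (_ * _); rewrite -mulrA; congr (e * _); rewrite big_split_ord /=; congr (_ * _).
    by apply: eq_bigr => i _; rewrite /x' ltn_ord.
  rewrite (eq_bigr (fun=> z j0 v)) ?prodr_const ?card_ord // => i _.
  by rewrite /x' ltnNge leq_addr.
apply: pred_funext Csum => v.
rewrite [RHS]mulrAC (_ : (fun j => z j v) = upd (fun j => z j v) (z j0 v)); last first.
  by apply: funext => j; rewrite /upd; case: eqP => [->|].
rewrite -psikE mulr_sumr mulr_suml; apply: eq_bigr => k _.
have -> : psik k (upd (fun j => z j v) (z j0 v)) (t v) = psik k (fun j => z j v) (t v).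
  apply: eq_bigr => y _; congr (_ * psi _ _); apply: funext => j.
  by rewrite /upd; case: eqP.
by ring.
Qed.

(** With [t] in place of [dot b z], the function depends only on the [e * z j] and on [(1 - e) * t],
    so [monomial_all] applies with [d = 0]. *)
Lemma rank_one_clone_fun (f : ('I_n -> R) -> R) (a b : 'I_n -> R) :
  clone_fun C f ->
  clone_fun C' (fun z => e * f (fun j => e * z j + (1 - e) * (a j * dot b z))).
Proof.
move=> Cf; have ee := idem_id c; have n_gt0 := clone_fun_gt0 cC Cf.
pose psi (z : 'I_n -> R) t := f (fun j => e * z j + (1 - e) * (a j * t)).
have C'psi : monomial_in C' 0 psi.
  apply: (@monomial_all (enum 'I_n)) => [z z' t zz' | z t | U z x t Cz Cx Ct].
  - by rewrite /psi; congr (e * f _); apply: funext => j; rewrite zz' ?mem_enum.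
  - by congr f; apply: funext => j; congr (_ + _); ring: ee.
  have linCU := linC (clone_fun_gt0 cC Ct).
  have Cg j : clone_fun C (fun v => e * z j v + (1 - e) * (a j * t v)).
    by apply: (linD linCU); do ?apply: (linZ linCU).
  have := linZ linCU e (clone_fun_comp cC Cf Cg); apply: pred_funext => v.
  by rewrite big_ord0 mulr1.
have proj j := clone_fun_proj (j : 'I_n) cC'.
have linCn := linC' n_gt0.
have Cdot : clone_fun C' (dot b).
  by apply: (lin_sum linCn) => j; apply: (linZ linCn).
have := C'psi _ (fun j z => z j) (fun=> dot b) _ proj (fun=> Cdot) Cdot.
by apply: pred_funext => z; rewrite big_ord0 mulr1.
Qed.

End Monomials.

Lemma coprime_prodr (I : Type) (r : seq I) (P : pred I) (F : I -> nat) k :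
  (forall i, P i -> coprime k (F i)) -> coprime k (\prod_(i <- r | P i) F i).
Proof.
move=> coF; apply: (big_ind (coprime k)) => [|a b|]; [exact: coprimen1 | | exact: coF].
by rewrite coprimeMr => -> ->.
Qed.

(** * Combining the primes *)

Section Components.
Local Open Scope ring_scope.
Variables (R : comNzRingType) (m : nat) (K : 'I_m -> finFieldType).
Variable c : forall i, component R (K i).
Hypothesis res_inj : forall r r' : R, (forall i, res (c i) r = res (c i) r') -> r = r'.
Hypothesis res_idem_neq : forall i j, i != j -> res (c j) (idem (c i)) = 0.
Hypothesis card_neq0 : forall i j, i != j -> #|K j|%:R != 0 :> K i.
Local Notation e i := (idem (c i)).

Lemma res_sum_idem (r : seq 'I_m) k : uniq r ->
  res (c k) (\sum_(l <- r) e l) = (k \in r)%:R.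
Proof.
elim: r => [|l r IHr] /= => [_|/andP[l_r r_uniq]]; first by rewrite big_nil rmorph0.
rewrite big_cons rmorphD IHr // inE; case: eqVneq => [->|ne_kl].
  by rewrite res_idem (negPf l_r) addr0.
by rewrite res_idem_neq ?add0r // eq_sym.
Qed.

Lemma sum_idem : \sum_i e i = 1.
Proof. by apply: res_inj => k; rewrite res_sum_idem ?index_enum_uniq // mem_index_enum rmorph1. Qed.

(** The components other than [i] are freed one at a time by [rank_one_generates], since [#|K l|] is
    invertible at [i] for [l != i]. *)
Lemma rank_one_outside_generates n i (S : (('I_n -> R) -> R) -> Prop)
    (linS : lin_closed S) (f : ('I_n -> R) -> R) :
  (forall a b, S (fun z => e i * f (fun j => e i * z j + (1 - e i) * (a j * dot b z)))) ->
  S (fun z => e i * f z).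
Proof.
move=> Sf.
have Sfr (r : seq 'I_m) (g := \sum_(l <- r) e l) : uniq r -> i \notin r ->
    (forall a b, S (fun z => e i * f (fun j => (1 - g) * z j + g * (a j * dot b z)))) ->
    S (fun z => e i * f z).
  rewrite {}/g; elim: r => [|l r IHr] /= => [_ _ /(_ (fun=> 0) (fun=> 0))|].
    apply: pred_funext => z; rewrite big_nil; congr (_ * f _); apply: funext => j.
    by rewrite subr0 mul1r mul0r addr0.
  move=> /andP[l_r r_uniq]; rewrite inE negb_or => /andP[ne_il i_r] Sg.
  apply: IHr => // a' b'; move: Sg; rewrite big_cons.
  set g' := \sum_(_ <- r) _ => Sg.
  have gl : g' * e l = 0.
    apply: res_inj => k; rewrite rmorphM rmorph0 res_sum_idem //.
    have [<-|ne_lk] := eqVneq l k; first by rewrite (negPf l_r) mul0r.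
    by rewrite res_idem_neq ?mulr0.
  have gg : g' * g' = g'.
    by apply: res_inj => k; rewrite rmorphM res_sum_idem // -natrM mulnb andbb.
  have ll := idem_id (c l).
  apply: (@rank_one_generates _ _ _ linS _ (c l) (lift (c i) #|K l|%:R^-1)).
    move=> z /=; rewrite mulrnAr -mulr_natr mulrCA -mulrA; apply: eq_idem.
    by rewrite !rmorphM rmorph_nat liftK mulrAC mulVf ?mul1r ?card_neq0.
  (* As [g'] and [e l] are orthogonal idempotents, rank one data at each glue to rank one data at
     their sum. *)
  move=> a b; have := Sg (fun j => g' * a' j + e l * a j) (fun j => g' * b' j + e l * b j).
  apply: pred_funext => z; congr (_ * f _); apply: funext => j; rewrite dotDZ.
  pose w k := (1 - e l) * z k + e l * (a k * dot b z).
  have gdot : g' * dot b' w = g' * dot b' z.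
    rewrite /dot !mulr_sumr; apply: eq_bigr => k _; rewrite /w.
    by ring: gl.
  rewrite [X in _ = _ + X]mulrCA gdot.
  by ring: gl gg ll.
pose r := [seq l <- index_enum 'I_m | l != i].
have r_uniq : uniq r by rewrite filter_uniq ?index_enum_uniq.
apply: (Sfr r) => //; first by rewrite mem_filter eqxx.
have -> : \sum_(l <- r) e l = 1 - e i.
  by rewrite big_filter -sum_idem [X in _ = X - _](bigD1 i) //= addrAC subrr add0r.
by move=> a b; apply: pred_funext (Sf a b) => z; rewrite subKr.
Qed.

End Components.

(** * The ring of integers modulo a squarefree number *)

Section ResidueRing.
Local Open Scope ring_scope.

(** The proofs are arguments so that the morphism instances, which rest on them, attach to this
    map. *)
Definition Zp_res s p (s_gt1 : (1 < s)%N) (p_prime : prime p) (dvd_ps : (p %| s)%N)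
    (r : 'Z_s) : 'F_p := (r : nat)%:R.

Section Morphism.
Variables (s p : nat) (s_gt1 : (1 < s)%N) (p_prime : prime p) (dvd_ps : (p %| s)%N).
Local Notation res := (Zp_res s_gt1 p_prime dvd_ps).

Lemma Fp_nat_eq0 n : ((n%:R : 'F_p) == 0) = (p %| n)%N.
Proof. by rewrite (dvdn_pcharf (pchar_Fp p_prime)). Qed.

Lemma Zp_res_modn n : (n %% s)%:R = n%:R :> 'F_p.
Proof.
have s0 : s%:R = 0 :> 'F_p by apply/eqP; rewrite Fp_nat_eq0.
by rewrite {2}(divn_eq n s) natrD natrM s0 mulr0 add0r.
Qed.

Lemma Zp_res_nat n : res n%:R = n%:R.
Proof. by rewrite /Zp_res val_Zp_nat // Zp_res_modn. Qed.

Lemma Zp_res_zmod_morphism : zmod_morphism res.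
Proof.
suff resD x y : res (x + y) = res x + res y.
  by move=> x y; apply/eqP; rewrite eq_sym subr_eq -resD subrK.
by rewrite -(natr_Zp x) -(natr_Zp y) -natrD !Zp_res_nat natrD.
Qed.

Lemma Zp_res_monoid_morphism : monoid_morphism res.
Proof.
split=> [|x y]; first exact: (Zp_res_nat 1).
by rewrite -(natr_Zp x) -(natr_Zp y) -natrM !Zp_res_nat natrM.
Qed.

HB.instance Definition _ := GRing.isZmodMorphism.Build _ _ res Zp_res_zmod_morphism.
HB.instance Definition _ := GRing.isMonoidMorphism.Build _ _ res Zp_res_monoid_morphism.
End Morphism.

Variables (m : nat) (p : 'I_m -> nat) (s : nat).
Hypotheses (s_gt1 : (1 < s)%N) (p_prime : forall i, prime (p i)) (p_inj : injective p).
Hypothesis def_s : s = (\prod_(i < m) p i)%N.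

Lemma dvdn_factor i : (p i %| s)%N.
Proof. by rewrite def_s (bigD1 i) //= dvdn_mulr. Qed.

Local Notation pi i := (Zp_res s_gt1 (p_prime i) (dvdn_factor i)).

Lemma coprime_factors i j : i != j -> coprime (p i) (p j).
Proof. by move=> ne_ij; rewrite prime_coprime // dvdn_prime2 // (inj_eq p_inj). Qed.

Lemma dvdn_factors n : (forall i, p i %| n)%N -> (s %| n)%N.
Proof.
move=> dvd_n; rewrite def_s; elim: index_enum (index_enum_uniq 'I_m) => [|i t IHt] /=.
  by rewrite big_nil dvd1n.
move=> /andP[i_t t_uniq]; rewrite big_cons Gauss_dvd ?dvd_n ?IHt //.
rewrite big_seq; apply: coprime_prodr => j j_t.
by apply: coprime_factors; apply: contraNneq i_t => ->.
Qed.

Lemma Zp_res_inj (r r' : 'Z_s) : (forall i, pi i r = pi i r') -> r = r'.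
Proof.
move=> eq_r; apply/eqP; rewrite -subr_eq0; set d := r - r'.
have d0 i : pi i d = 0 by rewrite rmorphB /= eq_r subrr.
have dvd_d : (s %| d)%N.
  by apply: dvdn_factors => i; rewrite -(Fp_nat_eq0 (p_prime i)); apply/eqP/d0.
rewrite -(natr_Zp d) -Zp_nat_mod // (eqP dvd_d).
by [].
Qed.

(** The idempotent of [p i], as the power of [s / p i] that Fermat's little theorem makes 1 modulo
    [p i]. *)
Definition cofactor_idem i : 'Z_s := (\prod_(j < m | j != i) p j)%:R ^+ (p i).-1.

Lemma res_cofactor_idem i : pi i (cofactor_idem i) = 1.
Proof.
rewrite /cofactor_idem rmorphXn rmorph_nat /=; set x := _%:R.
have x0 : x != 0.
  rewrite Fp_nat_eq0 // -prime_coprime //; apply: coprime_prodr => j ne_ji.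
  by apply: coprime_factors; rewrite eq_sym.
apply: (mulfI x0); rewrite mulr1 -exprS prednK ?prime_gt0 //.
by have := expf_card x; rewrite card_Fp.
Qed.

Lemma res_cofactor_idem_neq i j : i != j -> pi j (cofactor_idem i) = 0.
Proof.
move=> ne_ij; rewrite /cofactor_idem rmorphXn rmorph_nat /=.
rewrite (bigD1 j) /= ?(eq_sym j) // natrM.
have /eqP-> : (p j)%:R == 0 :> 'F_(p j) by rewrite Fp_nat_eq0.
by rewrite mul0r expr0n; case: (p i) (prime_gt1 (p_prime i)) => [|[]].
Qed.

Lemma eq_cofactor_idem i (r r' : 'Z_s) : pi i r = pi i r' ->
  cofactor_idem i * r = cofactor_idem i * r'.
Proof.
move=> eq_r; apply: Zp_res_inj => j; rewrite !rmorphM /=.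
by have [<-|ne_ij] := eqVneq i j; rewrite ?eq_r // res_cofactor_idem_neq ?mul0r.
Qed.

Lemma lift_natK i : cancel (fun x : 'F_(p i) => (x : nat)%:R) (pi i).
Proof. by move=> x; rewrite Zp_res_nat natr_Zp. Qed.

Definition Zp_component i : component 'Z_s 'F_(p i) :=
  Component (res := pi i) (@lift_natK i) (res_cofactor_idem i) (@eq_cofactor_idem i).

End ResidueRing.

Section LinearClosure.
Local Open Scope ring_scope.
Variables (s : nat) (C : set (operation 'Z_s)).
Hypotheses (s_gt1 : (1 < s)%N) (cC : is_clone C) (Cadd : C (op_add s)).

Lemma clone_fun_lin (U : finType) : (0 < #|U|)%N -> lin_closed (@clone_fun _ C U).
Proof.
move=> U_gt0.
have CD (F G : (U -> 'Z_s) -> 'Z_s) :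
    clone_fun C F -> clone_fun C G -> clone_fun C (fun v => F v + G v).
  move=> CF CG; have /(clone_funE _ cC) Cadd' := Cadd.
  have := clone_fun_comp cC Cadd'
    (fun i : 'I_2 => if i == ord0 as b return clone_fun C (if b then F else G) then CF else CG).
  by apply: pred_funext => v; rewrite !tnth_mktuple.
have CZn k (F : (U -> 'Z_s) -> 'Z_s) : clone_fun C F -> clone_fun C (fun v => k.+1%:R * F v).
  move=> CF; elim: k => [|k IHk]; first by apply: pred_funext CF => v; rewrite mul1r.
  by apply: pred_funext (CD _ _ CF IHk) => v; rewrite [in RHS]mulrS mulrDl mul1r.
have CZ (c : 'Z_s) (F : (U -> 'Z_s) -> 'Z_s) : clone_fun C F -> clone_fun C (fun v => c * F v).
  (* [c + s] represents the scalar [c] and is positive, as repeated addition requires. *)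
  move=> /(CZn (c + s.-1)%N); apply: pred_funext => v; congr (_ * _).
  rewrite -addnS prednK ?(ltnW s_gt1) // natrD natr_Zp.
  by rewrite pchar_Zp // addr0.
split=> //.
have := CZ 0 _ (clone_fun_proj (enum_val (Ordinal U_gt0)) cC).
by apply: pred_funext => v; rewrite mul0r.
Qed.

End LinearClosure.

Local Open Scope classical_set_scope.

(** * Generation by operations of small arity *)

Section Generation.
Variables (m : nat) (p : 'I_m -> nat) (s : nat).
Hypotheses (s_gt1 : (1 < s)%N) (p_prime : forall i, prime (p i)) (p_inj : injective p).
Hypothesis def_s : s = (\prod_(i < m) p i)%N.
Variables (C C' : set (operation 'Z_s)).
Hypotheses (cC : is_clone C) (cC' : is_clone C').
Hypotheses (Cadd : C (op_add s)) (C'add : C' (op_add s)).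
Hypothesis smallC : forall f, C f -> (arity f <= \max_(i < m) p i)%N -> C' f.
Local Open Scope ring_scope.

(** The idempotents sum to 1, so [f] is the sum of its parts [idem (c i) * f]. Each reduces to rank
    one form outside [p i], where [rank_one_clone_fun] needs only arities up to [p i]. *)
Lemma sub_clone : C `<=` C'.
Proof.
move=> [n f0] Cf0; apply/(clone_funE _ cC'); move/(clone_funE _ cC): Cf0.
set f := fun _ => _ => Cf.
have linC U := @clone_fun_lin s C s_gt1 cC Cadd U.
have linC' U := @clone_fun_lin s C' s_gt1 cC' C'add U.
have linn := linC' _ (clone_fun_gt0 cC Cf).
pose c := Zp_component s_gt1 p_prime p_inj def_s.
have res_inj r r' : (forall i, res (c i) r = res (c i) r') -> r = r'.
  exact: (@Zp_res_inj _ _ _ s_gt1 p_prime p_inj def_s).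
have idem_neq i j : i != j -> res (c j) (idem (c i)) = 0.
  exact: res_cofactor_idem_neq.
have -> : f = fun z => \sum_i idem (c i) * f z.
  by apply: funext => z; rewrite -mulr_suml (sum_idem res_inj idem_neq) mul1r.
apply: lin_sum => // i; apply: (rank_one_outside_generates res_inj idem_neq) => //.
  move=> k j ne_kj; rewrite card_Fp // Fp_nat_eq0 // dvdn_prime2 //.
  by rewrite (inj_eq p_inj).
move=> a b; apply: rank_one_clone_fun Cf => // [k|U F le_U].
  rewrite card_Fp // => /andP[k_gt0 lt_k].
  by rewrite Fp_nat_eq0 // gtnNdvd.
move=> CF; apply: smallC => //=; apply: leq_trans le_U _.
by rewrite card_Fp // (leq_bigmax i).
Qed.

End Generation.

Theorem corollary1p5 (m : nat) (p : 'I_m -> nat) (s : nat)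
    (m_gt0 : (0 < m)%N) (p_prime : forall i : 'I_m, prime (p i))
    (p_inj : injective p) (def_s : s = (\prod_(i < m) p i)%N)
    (C : set (operation 'Z_s)) (C_clone : is_clone C)
    (C_add : Clo [set op_add s] `<=` C) :
  exists F : set (operation 'Z_s),
    (forall f, F f -> (0 < arity f)%N /\ (arity f <= \max_(i < m) p i)%N) /\
    C = Clo F.
Proof.
pose N := \max_(i < m) p i.
(* This puts the binary [op_add] into [F]. *)
have N_gt1 : (1 < N)%N.
  exact: leq_trans (prime_gt1 (p_prime (Ordinal m_gt0))) (leq_bigmax _).
have s_gt1 : (1 < s)%N.
  apply: leq_trans (prime_gt1 (p_prime (Ordinal m_gt0))) (dvdn_leq _ _).
    by rewrite def_s prodn_gt0 // => i; apply: prime_gt0.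
  exact: (dvdn_factor def_s).
pose F := [set f | C f /\ (arity f <= N)%N].
have F_bound f : F f -> (0 < arity f)%N /\ (arity f <= N)%N.
  by move=> [Cf le_f]; split=> //; apply: (clone_arity C_clone).
have subF : F `<=` Clo F by move=> f Ff D [_]; apply.
have Cadd : C (op_add s) by apply: C_add => D [_]; apply.
exists F; split=> //; apply/seteqP; split.
  apply: (sub_clone s_gt1 p_prime p_inj def_s) => //.
  - by apply: is_clone_Clo => f /F_bound[].
  - by apply: subF; split.
  - by move=> f Cf le_f; apply: subF.
by move=> f; apply; split=> // g [].
Qed.
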